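(* Let $\rho,\sigma$ be density matrices on a finite-dimensional Hilbert space with $\sigma\succ\rho$. Then $$S(\rho)-S(\sigma)\ \ge\ \frac{C(\sigma)-C(\rho)}{S(\rho)+S(\sigma)+2}.$$
   Context: $S(\rho)=-\mathrm{Tr}(\rho\ln\rho)$ is the von Neumann entropy and $C(\rho)=\mathrm{Tr}[\rho(\ln\rho)^2]-S(\rho)^2$ is the variance of $-\ln\rho$ (zero eigenvalues contribute $0$ to the traces). Majorization: for density matrices $\rho_1,\rho_2$ of the same dimension $d$ with eigenvalues in decreasing order $\lambda_1\ge\dots\ge\lambda_d$ and $\kappa_1\ge\dots\ge\kappa_d$, $\rho_1\succ\rho_2$ means $\sum_{k=1}^m\lambda_k\ge\sum_{k=1}^m\kappa_k$ for all $m=1,\dots,d$. *)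

(* Defs.v *)
From mathcomp Require Import all_boot all_order all_algebra.
From mathcomp Require Import sesquilinear spectral complex.
From mathcomp Require Import reals exp.

Set Implicit Arguments.
Unset Strict Implicit.
Unset Printing Implicit Defensive.

Import Order.TTheory GRing.Theory Num.Theory.

Local Open Scope ring_scope.
Local Open Scope complex_scope.
Local Open Scope sesquilinear_scope.

(* The order of [R[i]] is partial: [0 <= z] says that z is real and           *)
(* nonnegative. The trace condition forces d > 0.                             *)
Definition density_matrix (R : realType) (d : nat) (A : 'M[R[i]]_d) : Prop :=
  [/\ A \is hermsymmx,
      forall v : 'cV[R[i]]_d, 0 <= (v ^t* *m A *m v) 0 0
    & \tr A = 1].

(* Matrix logarithm of a positive semidefinite matrix, by applying [ln] to    *)
(* the eigenvalues in the spectral decomposition                              *)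
(* A = invmx (spectralmx A) *m diag_mx (spectral_diag A) *m spectralmx A.     *)
(* Since [ln 0 = 0], the logarithm vanishes on the kernel of A, so that zero  *)
(* eigenvalues contribute 0 to the traces below.                              *)
Definition lnmx (R : realType) (d : nat) (A : 'M[R[i]]_d) : 'M[R[i]]_d :=
  invmx (spectralmx A)
    *m diag_mx (map_mx (fun z : R[i] => (ln (complex.Re z))%:C)
                       (spectral_diag A))
    *m spectralmx A.

(* The traces in the next two definitions are real for a density matrix;      *)
(* [complex.Re] only turns them into elements of R.                           *)
Definition entropy (R : realType) (d : nat) (A : 'M[R[i]]_d) : R :=
  - complex.Re (\tr (A *m lnmx A)).

Definition entropy_variance (R : realType) (d : nat) (A : 'M[R[i]]_d) : R :=
  complex.Re (\tr (A *m (lnmx A *m lnmx A))) - entropy A ^+ 2.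

(* Eigenvalues of a Hermitian matrix (they are real), with multiplicity, in   *)
(* decreasing order.                                                          *)
Definition eigenvalues (R : realType) (d : nat) (A : 'M[R[i]]_d) : seq R :=
  sort (fun x y : R => y <= x)
       [seq complex.Re (spectral_diag A 0 i) | i <- enum 'I_d].

Definition majorizes (R : realType) (d : nat) (A B : 'M[R[i]]_d) : Prop :=
  forall m : nat, (1 <= m <= d)%N ->
    \sum_(k < m) (eigenvalues B)`_k <= \sum_(k < m) (eigenvalues A)`_k.

(* Main.v *)
(** Writing M(rho) = Tr[rho (ln rho)^2], the denominator is positive and
    S(rho)^2 - S(sigma)^2 cancels against the squares in the variances, so the
    claim is equivalent to M(sigma) + 2 S(sigma) <= M(rho) + 2 S(rho). This is
    Karamata's inequality for f(x) = x (ln x)^2 - 2 x ln x, which is concave on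
    [0, 1] because f'(x) = (ln x)^2 - 2 is decreasing there. *)
Require Import Defs.
From mathcomp Require Import all_boot all_order all_algebra.
From mathcomp Require Import sesquilinear spectral complex.
From mathcomp Require Import normedtype derive.
From mathcomp Require Import reals exp.
From mathcomp Require Import ring lra.

Set Implicit Arguments.
Unset Strict Implicit.
Unset Printing Implicit Defensive.

Import Order.TTheory GRing.Theory Num.Theory.
Import numFieldNormedType.Exports.

Local Open Scope ring_scope.

(** Abel summation in inductive form: the earlier terms are bounded by the last weight times their
    partial sum, and since that partial sum is nonnegative the weight may be raised to the next
    one. *)
Lemma sum_nondecreasing_mul_le (R : realDomainType) (n : nat) (h e : nat -> R) :
  (forall i, (i < n)%N -> h i <= h i.+1) ->
  (forall m, (m <= n)%N -> 0 <= \sum_(k < m) e k) ->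
  \sum_(k < n.+1) h k * e k <= h n * \sum_(k < n.+1) e k.
Proof.
elim: n => [|n IHn] hmono epos; first by rewrite !big_ord1.
rewrite big_ord_recr [in leRHS]big_ord_recr /= mulrDr lerD2r.
apply: le_trans (IHn _ _) _ => [i lt_in|m le_mn|].
- by apply: hmono; exact: ltnW.
- by apply: epos; exact: leqW.
- by apply: ler_wpM2r; [exact: epos | exact: hmono].
Qed.

Definition xln2 (R : realType) (x : R) : R := x * ln x ^+ 2 - 2 * (x * ln x).

Lemma is_derive_xln2 (R : realType) (x : R) :
  0 < x -> is_derive x 1 (@xln2 R) (ln x ^+ 2 - 2).
Proof.
move=> x0; have dln := is_derive1_ln x0.
rewrite /xln2; apply: is_derive_eq.
rewrite /GRing.scale /=; field; exact: lt0r_neq0.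
Qed.

Lemma xln2_MVT (R : realType) (a b : R) : 0 < a -> a < b ->
  exists2 c, a < c < b & xln2 b - xln2 a = (ln c ^+ 2 - 2) * (b - a).
Proof.
move=> a0 ab.
have [||c] := @MVT R (@xln2 R) (fun x => ln x ^+ 2 - 2) a b ab.
- move=> x; rewrite in_itv /= => /andP[ax _].
  exact: is_derive_xln2 (lt_trans a0 ax).
- apply: derivable_within_continuous => x; rewrite in_itv /= => /andP[ax _].
  by have [] := is_derive_xln2 (lt_le_trans a0 ax).
by rewrite in_itv /= => cab eqf; exists c.
Qed.

Lemma sqr_ln_le (R : realType) (x y : R) : 0 < x -> x <= y -> y <= 1 ->
  ln y ^+ 2 <= ln x ^+ 2.
Proof.
move=> x0 xy y1; have y0 := lt_le_trans x0 xy.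
have lxy : ln x <= ln y by rewrite ler_ln ?posrE.
have ly : ln y <= 0 by exact: ln_le0.
nra.
Qed.

(** Concavity as a tangent-line bound: the mean value theorem gives a slope at a point between [a]
    and [b], compared with the slope at [b] by [sqr_ln_le]. *)
Lemma xln2_le_tangent (R : realType) (a b : R) : 0 <= a <= 1 -> 0 < b <= 1 ->
  xln2 a - xln2 b <= (ln b ^+ 2 - 2) * (a - b).
Proof.
move=> /andP[a0 a1] /andP[b0 b1].
have lb : ln b <= 0 by exact: ln_le0.
have [a_eq0|a_neq0] := eqVneq a 0.
  (* Here [xln2 0 = 0], and the claim reduces to [b * ln b <= b]. *)
  by rewrite a_eq0 /xln2 !mul0r; nra.
have {a_neq0}a0 : 0 < a by rewrite lt0r a_neq0.
have [ab|ba|->] := ltgtP a b; last by rewrite !subrr mulr0.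
- have [c /andP[ac cb] eqf] := xln2_MVT a0 ab.
  have := @sqr_ln_le _ _ _ (lt_trans a0 ac) (ltW cb) b1; nra.
- have [c /andP[bc ca] ->] := xln2_MVT b0 ba.
  have := @sqr_ln_le _ _ _ b0 (ltW bc) (ltW (lt_le_trans ca a1)); nra.
Qed.

(** Sum the tangent bounds taken at the points [b k]. As [b] decreases the slopes increase, so Abel
    summation bounds the total by the last slope times the sum of all [a k - b k], which is zero. *)
Lemma xln2_karamata (R : realType) (n : nat) (a b : nat -> R) :
  (forall k, (k < n)%N -> 0 <= a k <= 1) ->
  (forall k, (k < n)%N -> 0 <= b k <= 1) ->
  (forall k, (k.+1 < n)%N -> b k.+1 <= b k) ->
  (forall m, (m <= n)%N -> \sum_(k < m) b k <= \sum_(k < m) a k) ->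
  \sum_(k < n) a k = \sum_(k < n) b k ->
  \sum_(k < n) xln2 (a k) <= \sum_(k < n) xln2 (b k).
Proof.
case: n => [|n] a01 b01 bdecr maj sum_eq; first by rewrite !big_ord0.
(* [f] has infinite slope at 0; any constant [C] above all the chord slopes
   [f (a k) / a k] and all the slopes [f' (b k)] serves instead. *)
pose c k := ln (a k) ^+ 2 - 2 * ln (a k) + ln (b k) ^+ 2.
pose C := \sum_(k < n.+1) c k.
(* Since [ln (a k) <= 0], both parts of [c k] are nonnegative; hence the sum [C] dominates each
   [c k] and can stand in for a maximum. *)
have c_ge k : (k < n.+1)%N -> ln (a k) ^+ 2 - 2 * ln (a k) <= c k
    /\ ln (b k) ^+ 2 <= c k.
  move=> lt_kn; have /andP[_ a1] := a01 k lt_kn.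
  by have := ln_le0 a1; rewrite /c; split; nra.
have c_le_C k : (k < n.+1)%N -> c k <= C.
  move=> lt_kn; rewrite /C (bigD1 (Ordinal lt_kn)) //= lerDl sumr_ge0 // => i _.
  by have [_] := c_ge i (ltn_ord i); apply: le_trans; exact: sqr_ge0.
pose h k := if 0 < b k then ln (b k) ^+ 2 - 2 else C.
have h_mono k : (k < n)%N -> h k <= h k.+1.
  move=> lt_kn; have b_le := bdecr k lt_kn.
  have /andP[b0 b1] := b01 k (leqW lt_kn).
  rewrite /h; case: ifP => [bk|bk]; case: ifP => [bk1|bk1] //.
  - by rewrite lerD2r; exact: sqr_ln_le.
  - have [_] := c_ge k (leqW lt_kn); have := c_le_C k (leqW lt_kn); lra.
  - by rewrite (lt_le_trans bk1 b_le) in bk.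
have tangent k : (k < n.+1)%N -> xln2 (a k) - xln2 (b k) <= h k * (a k - b k).
  move=> lt_kn; have /andP[b0 b1] := b01 k lt_kn; rewrite /h.
  case: ifPn => [bk|]; first by apply: xln2_le_tangent; rewrite ?a01 ?bk.
  rewrite -leNgt => bk; have -> : b k = 0 by apply/le_anti; rewrite bk.
  (* At [b k = 0] what remains is the chord bound [xln2 (a k) <= C * a k]. *)
  have [ac _] := c_ge k lt_kn; have cC := c_le_C k lt_kn.
  have /andP[a0 _] := a01 k lt_kn.
  rewrite /xln2 !mul0r; nra.
rewrite -subr_le0 -sumrB.
apply: (@le_trans _ _ (\sum_(k < n.+1) h k * (a k - b k))).
  by apply: ler_sum => k _; exact: tangent.
apply: le_trans (@sum_nondecreasing_mul_le _ n h (fun k => a k - b k) _ _) _.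
- exact: h_mono.
- by move=> m le_mn; rewrite sumrB subr_ge0 maj // leqW.
- by rewrite sumrB sum_eq subrr mulr0.
Qed.

Section Spectrum.
Variables (R : realType) (d : nat) (A : 'M[R[i]]_d).
Hypothesis hA : density_matrix A.

Local Notation lam := (fun i : 'I_d => complex.Re (spectral_diag A 0 i)).
Local Notation P := (spectralmx A).

Lemma density_spectralE : A = invmx P *m diag_mx (spectral_diag A) *m P.
Proof. by have [/hermitian_normalmx/orthomx_spectralP] := hA. Qed.

Lemma density_spectral_diag_ge0 (i : 'I_d) : 0 <= spectral_diag A 0 i.
Proof.
have [_ pos _] := hA.
(* The [i]-th eigenvector: as [P] is unitary, the quadratic form at [v] is exactly the [i]-th
   eigenvalue. *)
pose v : 'cV[R[i]]_d := invmx P *m delta_mx i 0.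
have := pos v; suff -> : ((v ^t* *m A *m v) 0 0)%sesqui = spectral_diag A 0 i by [].
have -> : (v ^t* = delta_mx 0 i *m P)%sesqui.
  rewrite /v invmx_unitary ?spectral_unitarymx // trmx_mul map_mxM /=.
  rewrite trmxCK trmx_delta; congr (_ *m _).
  by apply/matrixP => j k; rewrite !mxE rmorph_nat.
rewrite {2}density_spectralE /v !mulmxA.
rewrite !mulmxK ?spectral_unit //.
rewrite -rowE row_diag_mx -scalemxAl -rowE !mxE !eqxx mulr1 //.
Qed.

Lemma density_spectral_diagE (i : 'I_d) : spectral_diag A 0 i = ((lam i)%:C)%C.
Proof.
by have := density_spectral_diag_ge0 i; case: (spectral_diag A 0 i) => x y;
  rewrite lecE /= => /andP[/eqP-> _].
Qed.

Lemma density_eigenvalue_ge0 (i : 'I_d) : 0 <= lam i.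
Proof. by have := density_spectral_diag_ge0 i; rewrite density_spectral_diagE lecR. Qed.

(** Cyclicity of the trace cancels the conjugation by [P]. The trace of [A], the entropy and the
    second moment of [ln] are all evaluated this way. *)
Lemma Re_trace_diag (v : 'rV[R[i]]_d) (F : R -> R) :
  (forall i, v 0 i = ((F (lam i))%:C)%C) ->
  complex.Re (\tr (invmx P *m diag_mx v *m P)) = \sum_i F (lam i).
Proof.
move=> hv; rewrite mxtrace_mulC mulmxA mulmxV ?spectral_unit // mul1mx.
rewrite mxtrace_diag raddf_sum /=; apply: eq_bigr => i _; by rewrite hv.
Qed.

Lemma size_eigenvalues : size (eigenvalues A) = d.
Proof. by rewrite size_sort size_map size_enum_ord. Qed.

Lemma sum_eigenvalues (F : R -> R) :
  \sum_i F (lam i) = \sum_(k < d) F (eigenvalues A)`_k.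
Proof.
have perm : perm_eq (eigenvalues A) [seq lam i | i <- enum 'I_d].
  by rewrite /eigenvalues perm_sort.
transitivity (\sum_(x <- eigenvalues A) F x).
  by rewrite (perm_big _ perm) big_map big_enum.
by rewrite (big_nth 0) size_eigenvalues big_mkord.
Qed.

Lemma density_sum_eigenvalues : \sum_(k < d) (eigenvalues A)`_k = 1.
Proof.
rewrite -(sum_eigenvalues id).
rewrite -(@Re_trace_diag (spectral_diag A) id) -?density_spectralE.
  by have [_ _ ->] := hA.
exact: density_spectral_diagE.
Qed.

Lemma density_entropyE :
  entropy A = - \sum_(k < d) (eigenvalues A)`_k * ln (eigenvalues A)`_k.
Proof.
rewrite -(sum_eigenvalues (fun x => x * ln x)) /entropy; congr (- _).
set L := (X in lnmx X); rewrite {1}density_spectralE /L /lnmx.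
rewrite !mulmxA mulmxK ?spectral_unit //.
rewrite -(mulmxA _ (diag_mx _) (diag_mx _)) mulmx_diag.
rewrite (@Re_trace_diag _ (fun x => x * ln x)) // => i.
by rewrite !mxE rmorphM /= -density_spectral_diagE.
Qed.

Lemma density_entropy_varianceE : entropy_variance A =
  \sum_(k < d) (eigenvalues A)`_k * ln (eigenvalues A)`_k ^+ 2 - entropy A ^+ 2.
Proof.
rewrite -(sum_eigenvalues (fun x => x * ln x ^+ 2)) /entropy_variance.
congr (_ - _); set L := lnmx A; rewrite {1}density_spectralE /L /lnmx.
rewrite !mulmxA !mulmxK ?spectral_unit //.
rewrite -2!(mulmxA (invmx _)) !mulmx_diag.
rewrite (@Re_trace_diag _ (fun x => x * ln x ^+ 2)) // => i.
by rewrite !mxE expr2 !rmorphM /= -density_spectral_diagE mulrA.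
Qed.

Lemma density_eigenvalues_itv (k : nat) :
  (k < d)%N -> 0 <= (eigenvalues A)`_k <= 1.
Proof.
have pos j : (j < d)%N -> 0 <= (eigenvalues A)`_j.
  move=> lt_j; have : (eigenvalues A)`_j \in eigenvalues A.
    by rewrite mem_nth // size_eigenvalues.
  rewrite mem_sort => /mapP[i _ ->]; exact: density_eigenvalue_ge0.
move=> lt_k; rewrite pos //= -density_sum_eigenvalues.
by rewrite (bigD1 (Ordinal lt_k)) //= lerDl sumr_ge0 // => i _; exact: pos.
Qed.

Lemma eigenvalues_nonincreasing (k : nat) :
  (k.+1 < d)%N -> (eigenvalues A)`_k.+1 <= (eigenvalues A)`_k.
Proof.
move=> lt_k; have /sortedP : sorted (fun x y : R => y <= x) (eigenvalues A).
  by apply: sort_sorted => x y; exact: le_total.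
by apply; rewrite size_eigenvalues.
Qed.

Lemma density_entropy_ge0 : 0 <= entropy A.
Proof.
rewrite density_entropyE -sumrN sumr_ge0 // => k _.
have /andP[x0 x1] := density_eigenvalues_itv (ltn_ord k).
by rewrite oppr_ge0 mulr_ge0_le0 // ln_le0.
Qed.

Lemma sum_xln2_eigenvalues : \sum_(k < d) xln2 (eigenvalues A)`_k =
  entropy_variance A + entropy A ^+ 2 + 2 * entropy A.
Proof.
by rewrite sumrB -mulr_sumr density_entropy_varianceE subrK density_entropyE mulrN.
Qed.

End Spectrum.

Theorem mainTheorem2 (R : realType) (d : nat) (rho sigma : 'M[R[i]]_d)
    (hrho : density_matrix rho) (hsigma : density_matrix sigma)
    (hmaj : majorizes sigma rho) :
  entropy rho - entropy sigma >=
  (entropy_variance sigma - entropy_variance rho)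
    / (entropy rho + entropy sigma + 2).
Proof.
have Sr := density_entropy_ge0 hrho; have Ss := density_entropy_ge0 hsigma.
have := @xln2_karamata R d (nth 0 (eigenvalues sigma)) (nth 0 (eigenvalues rho))
  (@density_eigenvalues_itv _ _ _ hsigma) (@density_eigenvalues_itv _ _ _ hrho)
  (@eigenvalues_nonincreasing _ _ rho).
rewrite (sum_xln2_eigenvalues hrho) (sum_xln2_eigenvalues hsigma).
rewrite (density_sum_eigenvalues hrho) (density_sum_eigenvalues hsigma).
move=> /(_ _ erefl) karamata.
have {karamata} : entropy_variance sigma + entropy sigma ^+ 2 + 2 * entropy sigma
    <= entropy_variance rho + entropy rho ^+ 2 + 2 * entropy rho.
  (* [majorizes] starts at [m = 1]; the case [m = 0] compares empty sums. *)
  by apply: karamata => -[|m] le_m; [rewrite !big_ord0 | exact: hmaj].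
move: (entropy rho) (entropy sigma) (entropy_variance rho)
  (entropy_variance sigma) Sr Ss => x y u v x0 y0 uv.
have xy0 : 0 < x + y + 2 by lra.
(* Clearing the denominator, [(x - y) * (x + y + 2) = x ^+ 2 - y ^+ 2 + 2 * (x - y)] turns the goal
   into [uv]. *)
by rewrite ler_pdivrMr //; lra.
Qed.
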